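(* Let $p\geqslant 11$ be a prime number with $p\equiv 1\bmod 5$, let $s$ be a primitive fifth root of unity in $\mathbb{Z}_p$, and let $$\hat{\mathbf{G}}_{s,s^2}=\langle a,b,c,d : a^p=b^p=c^5=d^2=[a,b]=(da)^2=(db)^2=1,\ cac^{-1}=a^s,\ cbc^{-1}=b^{s^2},\ dcd=a^{1-s}b^{1-s^2}c\rangle .$$ Up to duality, there are exactly two chiral pairs of orientably-regular maps of Euler characteristic $-2p^2$ of type $\{5,10\}$ with orientation-preserving automorphism group isomorphic to $\hat{\mathbf{G}}_{s,s^2}$.
   Context: A map $\mathscr{M}$ on a compact connected oriented surface $X$ is an embedding in $X$ of a finite connected graph whose complement is a disjoint union of topological discs, called faces. The Euler characteristic of the map is that of $X$. An automorphism of $\mathscr{M}$ is an incidence-preserving permutation of its edges, vertices and faces induced by a homeomorphism of $X$; $\mathrm{Aut}^+(\mathscr{M})$ is the group of those induced by orientation-preserving homeomorphisms. The map is orientably-regular if $\mathrm{Aut}^+(\mathscr{M})$ acts regularly on the set of arcs (edges endowed with a direction). Its type is $\{m,k\}$, where $k$ is the degree of each vertex and $m$ the size of each face. Equivalently, isomorphism classes of orientably-regular maps of type $\{m,k\}$ correspond to the finite index torsion-free normal subgroups $\Gamma$ of the triangle group $\Delta(2,m,k)=\langle y_1,y_2,y_3 : y_1^2=y_2^m=y_3^k=y_1y_2y_3=1\rangle$, with $\mathrm{Aut}^+(\mathscr{M})\cong\Delta(2,m,k)/\Gamma$. The dual map interchanges the roles of vertices and faces. An orientably-regular map is reflexive if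 it admits an orientation-reversing automorphism, and chiral otherwise; a chiral map $\mathscr{M}$ and its mirror image $\bar{\mathscr{M}}$ form a chiral pair. Maps are counted up to orientation-preserving isomorphism. *)

(* Defs.v *)
From mathcomp Require Import all_boot all_order all_algebra all_fingroup.

Set Implicit Arguments.
Unset Strict Implicit.
Unset Printing Implicit Defensive.

Import GRing.Theory.
Local Open Scope group_scope.

(* A map on a compact connected oriented surface, given by its rotation
   system.  The darts are the arcs (directed edges): [dart_rot] sends an arc to
   the next one counterclockwise around its initial vertex, and [dart_rev]
   reverses the direction of an arc.  Loops and multiple edges are allowed.
   Transitivity of the generated group is connectedness; note that
   [transitive] also entails that there is at least one arc. *)
Record oriented_map := OMap {
  dart : finType;
  dart_rot : {perm dart};
  dart_rev : {perm dart};
  dart_revK : involutive dart_rev;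
  dart_rev_neq : forall x : dart, dart_rev x != x;
  omap_conn : [transitive <<[set dart_rot; dart_rev]>>, on [set: dart] | 'P]
}.

(* The next arc along the boundary of the face to the left of a given arc:
   reverse the arc, then turn clockwise.  (In [s * t], [s] is applied first.) *)
Definition dart_face (M : oriented_map) : {perm dart M} :=
  dart_rev M * (dart_rot M)^-1.

(* Each vertex, edge or face is represented by its set of arcs: those leaving
   the vertex, the two directions of the edge, those with the face on their
   left. *)
Definition vertices (M : oriented_map) : {set {set dart M}} :=
  porbits (dart_rot M).
Definition edges (M : oriented_map) : {set {set dart M}} :=
  porbits (dart_rev M).
Definition faces (M : oriented_map) : {set {set dart M}} :=
  porbits (dart_face M).

Definition euler_char (M : oriented_map) : int :=
  (#|vertices M|%:Z - #|edges M|%:Z + #|faces M|%:Z)%R.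

Definition has_type (M : oriented_map) (m k : nat) : Prop :=
  (forall F, F \in faces M -> #|F| = m) /\
  (forall V, V \in vertices M -> #|V| = k).

(* Orientation-preserving automorphisms: the permutations of the arcs which
   commute with both the rotation and the reversal. *)
Definition AutP (M : oriented_map) : {group {perm dart M}} :=
  'C([set dart_rot M; dart_rev M])%G.

(* Regular action = transitive with trivial point stabilisers. *)
Definition orientably_regular (M : oriented_map) : Prop :=
  [transitive AutP M, on [set: dart M] | 'P] /\
  (forall x : dart M, 'C_(AutP M)[x | 'P] = 1).

Definition orient_iso (M N : oriented_map) : Prop :=
  exists f : dart M -> dart N,
    [/\ bijective f,
        forall x, f (dart_rot M x) = dart_rot N (f x)
      & forall x, f (dart_rev M x) = dart_rev N (f x)].

(* Admitting an orientation-reversing automorphism: it reverses the cyclic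
   order of the arcs around each vertex. *)
Definition has_orient_reversing_aut (M : oriented_map) : Prop :=
  exists f : {perm dart M},
    (forall x, f (dart_rot M x) = (dart_rot M)^-1 (f x)) /\
    (forall x, f (dart_rev M x) = dart_rev M (f x)).

Definition reflexive_map (M : oriented_map) : Prop :=
  orientably_regular M /\ has_orient_reversing_aut M.

Definition chiral_map (M : oriented_map) : Prop :=
  orientably_regular M /\ ~ reflexive_map M.

Lemma mirror_conn (M : oriented_map) :
  [transitive <<[set (dart_rot M)^-1; dart_rev M]>>, on [set: dart M] | 'P].
Proof.
suff -> : <<[set (dart_rot M)^-1; dart_rev M]>> = <<[set dart_rot M; dart_rev M]>>.
  exact: omap_conn.
apply/eqP; rewrite eqEsubset !gen_subG !subUset !sub1set.
have rotV : dart_rot M \in <<[set (dart_rot M)^-1; dart_rev M]>>.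
  by rewrite -groupV mem_gen // set21.
by rewrite rotV groupV !mem_gen ?set21 ?set22.
Qed.

(* The mirror image: the same graph, the surface having the opposite
   orientation. *)
Definition map_mirror (M : oriented_map) : oriented_map :=
  OMap (dart_revK (o := M)) (dart_rev_neq (o := M)) (mirror_conn M).

Lemma dual_conn (M : oriented_map) :
  [transitive <<[set dart_face M; dart_rev M]>>, on [set: dart M] | 'P].
Proof.
suff -> : <<[set dart_face M; dart_rev M]>> = <<[set dart_rot M; dart_rev M]>>.
  exact: omap_conn.
have rotE : dart_rot M = (dart_face M)^-1 * dart_rev M.
  by rewrite /dart_face invMg invgK mulgKV.
apply/eqP; rewrite eqEsubset !gen_subG !subUset !sub1set.
have inrot : dart_rot M \in <<[set dart_face M; dart_rev M]>>.
  by rewrite rotE groupM ?groupV ?mem_gen ?set21 ?set22.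
by rewrite inrot groupM ?groupV ?mem_gen ?set21 ?set22.
Qed.

(* The dual map, on the same oriented surface.  A dart of [M] also stands for
   the dual arc crossing it from the face on its left to that on its right. *)
Definition map_dual (M : oriented_map) : oriented_map :=
  OMap (dart_revK (o := M)) (dart_rev_neq (o := M)) (dual_conn M).

(* The isomorphism class of [N] is one of the two which make up the chiral
   pair of [M]. *)
Definition same_pair (M N : oriented_map) : Prop :=
  orient_iso M N \/ orient_iso (map_mirror M) N.

Definition same_pair_up_to_duality (M N : oriented_map) : Prop :=
  same_pair M N \/ same_pair (map_dual M) N.

(* [G] is isomorphic to the group \hat{G}_{s,s^2}.  The exponents are elements
   of F_p, coerced to their representatives in {0, ..., p-1}; this is harmless
   as a^p = b^p = 1.  The presented group is finite (of order dividing 10p^2),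
   so that [\isog Grp] really is isomorphism with it. *)
Definition isog_Ghat (p : nat) (s : 'F_p) (gT : finGroupType) (G : {group gT})
    : Prop :=
  G \isog Grp (a : b : c : d :
    a ^+ p = b ^+ p = 1, c ^+ 5 = d ^+ 2 = 1, [~ a, b] = 1,
    (d * a) ^+ 2 = (d * b) ^+ 2 = 1,
    c * a * c^-1 = a ^+ s,
    c * b * c^-1 = b ^+ (s ^+ 2)%R,
    d * c * d = a ^+ (1 - s)%R * b ^+ (1 - s ^+ 2)%R * c).

(* A member of one of the chiral pairs to be counted. *)
Definition counted_map (p : nat) (s : 'F_p) (M : oriented_map) : Prop :=
  [/\ chiral_map M,
      euler_char M = (- (2 * p ^ 2)%N%:Z)%R,
      has_type M 5 10
    & isog_Ghat s (AutP M)].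

(* Main.v *)
From HB Require Import structures.
Require Import Defs.
From mathcomp Require Import all_boot all_order all_algebra all_fingroup cyclic.
From mathcomp Require Import ring zify.

Set Implicit Arguments.
Unset Strict Implicit.
Unset Printing Implicit Defensive.

Import GRing.Theory.
Local Open Scope group_scope.

(** Why the theorem holds.

    A regular map is determined by its group and two elements of it: identify
    the arcs with the orientation-preserving automorphisms by letting these act
    on a base arc, and record the automorphisms r and l sending the base arc to
    the next arc around its vertex and to its reverse.  The rotation and the
    reversal become left multiplication by r and by l, the automorphisms become
    right multiplications, l is an involution and r, l generate.  So maps with
    group G are the generating pairs (r, l) of G with l an involution, and
    isomorphisms of maps are the isomorphisms of groups matching the pairs
    ([regular_cayley], [cayley_iso_of_morph], [morph_of_cayley_iso]).  The
    mirror image replaces r by its inverse; the degrees of the vertices and the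
    sizes of the faces are the orders of r and of r^-1 l.

    The presented group is the semidirect product of F_p x F_p with Z/10 in
    which the generator t of Z/10 acts as diag(la, mu), la = -s and mu = -s^2,
    both primitive tenth roots of unity ([isog_Ghat_twisted]).  Geometrically
    a, b are the translations by the unit vectors, c = t^6 acts as
    diag(s, s^2), and d is the point reflection x |-> (1, 1) - x; in the other
    direction t = a^-1 b^-1 d c.

    Every automorphism of this group acts trivially on the quotient Z/10
    ([rot_part_aut]).  Indeed the translations are the commutators, and on them
    t has the eigenvalues la and mu; an automorphism inducing multiplication
    by i on Z/10 must satisfy {la^i, mu^i} = {la, mu}.  As mu = la^7, the only
    alternative to i = 1 is i = 7, which fails since 49 is not 1 modulo 10.  So
    the image k of r in Z/10 is an invariant of the map.

    It is a complete one ([rotary_normal_form], [rot_part_cayley_iso]).  The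
    involution l lies over 5 and fixes a point of the plane, which a
    translation moves to the origin; then r becomes (u, v, k), and u, v are
    nonzero, since otherwise the pair would not generate.  Diagonal matrices
    are automorphisms, so (u, v) may be scaled to (1, 1).

    Faces of size 5 force k to be odd, and generation excludes k = 5; so k is
    one of 1, -1, 3, -3, and each of these units occurs
    ([standard_rotary], [std_map_counted]).  Since the mirror image changes k
    into -k, these four maps are all chiral and form two chiral pairs.  Duality
    exchanges degrees 5 and 10, so it does not identify the two pairs. *)

(** * Maps given by generating pairs of a group *)

Section Cayley.

Variable gT : finGroupType.
Implicit Types r l x y z : gT.

Definition rotary_pair r l := #[l] = 2 /\ <<[set r; l]>> = [set: gT].

(** The group being finite, every element is a product of copies of r and l
    without inverses. *)
Lemma rotary_ind r l (P : gT -> Prop) : rotary_pair r l ->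
  P 1 -> (forall x, P x -> P (r * x)) -> (forall x, P x -> P (l * x)) ->
  forall x, P x.
Proof.
move=> [_ genG] P1 Pr Pl x; have: x \in <<[set r; l]>> by rewrite genG inE.
case/gen_prodgP=> n [c Ac ->]; elim: n c Ac => [|n IHn] c Ac.
  by rewrite big_ord0.
rewrite big_ord_recl; have := IHn _ (fun i => Ac (lift ord0 i)).
by move: (Ac ord0); rewrite !inE => /orP[] /eqP->; [apply: Pr | apply: Pl].
Qed.

Definition lmul x : {perm gT} := perm (mulgI x).

Lemma lmulE x y : lmul x y = x * y. Proof. by rewrite permE. Qed.

Lemma lmulV x y : (lmul x)^-1 y = x^-1 * y.
Proof. by apply: (@perm_inj _ (lmul x)); rewrite permKV lmulE mulKVg. Qed.

Lemma lmulX x n y : (lmul x ^+ n) y = x ^+ n * y.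
Proof.
elim: n => [|n IHn]; first by rewrite !expg0 perm1 mul1g.
by rewrite expgSr permM IHn lmulE expgS mulgA.
Qed.

Lemma order_lmul x : #[lmul x] = #[x].
Proof.
apply/eqP; rewrite eqn_dvd !order_dvdn; apply/andP; split; apply/eqP.
  by apply/permP=> y; rewrite lmulX expg_order mul1g perm1.
by rewrite -[_ ^+ _]mulg1 -lmulX expg_order perm1.
Qed.

(** The left multiplications act freely, so all cycles have full length. *)
Lemma card_porbit_lmul x y : #|porbit (lmul x) y| = #[x].
Proof.
rewrite porbitE card_orbit -order_lmul; apply/eqP.
rewrite -divgS ?subsetIl //= (_ : 'C_(_)[_ | _] = 1) ?cards1 ?divn1 //.
apply/trivgP/subsetP=> a /setIP[/cycleP[n ->]] /astab1P /=.
rewrite apermE lmulX => /(canRL (mulgK y)); rewrite mulgV => xn1.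
by rewrite inE; apply/eqP/permP=> z; rewrite lmulX xn1 mul1g perm1.
Qed.

Variables (r l : gT) (rlP : rotary_pair r l).

Lemma cayley_revK : involutive (lmul l).
Proof.
by move=> x; rewrite !lmulE mulgA -expg2 -rlP.1 expg_order mul1g.
Qed.

Lemma cayley_rev_neq x : lmul l x != x.
Proof.
rewrite lmulE -{2}[x]mul1g (inj_eq (mulIg x)) -order_eq1.
by rewrite rlP.1.
Qed.

Lemma cayley_conn : [transitive <<[set lmul r; lmul l]>>, on [set: gT] | 'P].
Proof.
apply/imsetP; exists 1 => //; apply/esym/eqP; rewrite eqEsubset subsetT /=.
apply/subsetP=> x _; move: x; apply: (rotary_ind rlP) => [|x|x].
- exact: orbit_refl.
- case/orbitP=> f genf <-; apply/orbitP; exists (f * lmul r).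
    by rewrite groupM // mem_gen // set21.
  by rewrite /= !apermE permM lmulE.
case/orbitP=> f genf <-; apply/orbitP; exists (f * lmul l).
  by rewrite groupM // mem_gen // set22.
by rewrite /= !apermE permM lmulE.
Qed.

Definition cayley_map : oriented_map :=
  OMap cayley_revK cayley_rev_neq cayley_conn.

(** Commuting with r and l on the left means commuting with the whole left
    regular representation. *)
Lemma cayley_AutP (f : {perm gT}) :
  f \in AutP cayley_map -> forall x, f x = x * f 1.
Proof.
move=> /centP cf x; move: x; apply: (rotary_ind rlP) => [|x fx|x fx].
  by rewrite mul1g.
  by rewrite -mulgA -fx -!lmulE -!permM (cf (lmul r)) ?set21.
by rewrite -mulgA -fx -!lmulE -!permM (cf (lmul l)) ?set22.
Qed.

Lemma rmul_AutP x : perm (mulIg x) \in AutP cayley_map.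
Proof.
apply/centP=> f; rewrite !inE => /orP[] /eqP-> /=; apply/permP=> y;
  by rewrite !permM !lmulE !permE /= ?lmulE mulgA.
Qed.

Lemma isog_AutP_cayley : AutP cayley_map \isog [set: gT].
Proof.
pose h (x : gT) : {perm gT} := perm (mulIg x).
have hM : {in [set: gT] &, {morph h : x y / x * y}}.
  by move=> x y _ _; apply/permP=> z; rewrite permM !permE mulgA.
rewrite isog_sym; apply/isogP; exists (Morphism hM).
  apply/injmP=> x y _ _ /= /permP/(_ 1).
  by rewrite !permE !mul1g.
apply/setP=> f; apply/morphimP/idP => [[x _ _ ->] | Af]; first exact: rmul_AutP.
exists (f 1); rewrite ?inE //; apply/permP=> x.
by rewrite (cayley_AutP Af) permE.
Qed.

Lemma cayley_regular : orientably_regular cayley_map.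
Proof.
split=> [|x].
  apply/imsetP; exists 1 => //; apply/esym/eqP; rewrite eqEsubset subsetT /=.
  apply/subsetP=> x _; apply/orbitP; exists (perm (mulIg x)).
    exact: rmul_AutP.
  by rewrite /= apermE permE mul1g.
apply/trivgP/subsetP=> f /setIP[Af /astab1P /=].
rewrite apermE (cayley_AutP Af) -{2}[x]mulg1 => /mulgI f1.
by rewrite inE; apply/eqP/permP=> y; rewrite (cayley_AutP Af) f1 mulg1 perm1.
Qed.

Lemma cayley_face x : dart_face cayley_map x = (r^-1 * l) * x.
Proof. by rewrite /dart_face permM lmulE lmulV mulgA. Qed.

Lemma cayley_faceE : dart_face cayley_map = lmul (r^-1 * l).
Proof. by apply/permP=> x; rewrite cayley_face lmulE. Qed.

Lemma cayley_type : has_type cayley_map #[r^-1 * l] #[r].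
Proof.
split=> X.
  by rewrite /faces cayley_faceE => /imsetP[x _ ->]; apply: card_porbit_lmul.
by case/imsetP=> x _ ->; apply: card_porbit_lmul.
Qed.

Lemma card_porbits_lmul x : (#|porbits (lmul x)| * #[x])%N = #|gT|.
Proof.
rewrite -cardsT; apply/esym; apply: card_uniform_partition => [A /imsetP[y _ ->]|].
  exact: card_porbit_lmul.
have := @orbit_partition _ _ _ 'P <[lmul x]> [set: gT].
have -> : orbit 'P <[lmul x]> @: [set: gT] = porbits (lmul x).
  by apply/setP=> A; apply/imsetP/imsetP=> [] [y _ ->]; exists y; rewrite // porbitE.
by apply; apply/subsetP=> a _; rewrite !inE; apply/subsetP=> y; rewrite !inE.
Qed.

End Cayley.

Lemma orient_iso_sym M N : orient_iso M N -> orient_iso N M.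
Proof.
move=> [f [[g fK gK] fr fl]]; exists g; split=> [|x|x]; first by exists f.
  by apply: (can_inj fK); rewrite fr !gK.
by apply: (can_inj fK); rewrite fl !gK.
Qed.

Lemma orient_iso_trans M N P : orient_iso M N -> orient_iso N P -> orient_iso M P.
Proof.
move=> [f [bf fr fl]] [g [bg gr gl]]; exists (g \o f).
by split=> [|x|x] /=; [exact: bij_comp | rewrite fr gr | rewrite fl gl].
Qed.

(** * Isomorphisms of maps and of groups *)

Lemma cayley_iso_of_morph (gT hT : finGroupType) (r l : gT) (r' l' : hT)
    (P : rotary_pair r l) (P' : rotary_pair r' l') (F : gT -> hT) :
  bijective F -> {morph F : x y / x * y} -> F r = r' -> F l = l' ->
  orient_iso (cayley_map P) (cayley_map P').
Proof.
move=> bF FM Fr Fl; exists F; split=> // x /=.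
  by rewrite !lmulE FM Fr.
by rewrite !lmulE FM Fl.
Qed.

(** A map isomorphism commutes with the left multiplications; composed with the
    right multiplication which makes it fix 1, it becomes a group morphism. *)
Lemma morph_of_cayley_iso (gT hT : finGroupType) (r l : gT) (r' l' : hT)
    (P : rotary_pair r l) (P' : rotary_pair r' l') :
  orient_iso (cayley_map P) (cayley_map P') ->
  exists F : gT -> hT,
    [/\ bijective F, {morph F : x y / x * y}, F r = r' & F l = l'].
Proof.
move=> [f [bf fr fl]]; have {}fr x : f (r * x) = r' * f x.
  by have := fr x; rewrite /= !lmulE.
have {}fl x : f (l * x) = l' * f x by have := fl x; rewrite /= !lmulE.
exists (fun x => f x * (f 1)^-1); split.
- apply: inj_card_bij; first by move=> x y /mulIg /(bij_inj bf).
  by rewrite -(bij_eq_card bf).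
- move=> x y; move: x; apply: (rotary_ind P) => [|x IHx|x IHx].
  + by rewrite !mul1g mulgV mul1g.
  + by rewrite -(mulgA r) !fr -(mulgA r') IHx !mulgA.
  by rewrite -(mulgA l) !fl -(mulgA l') IHx !mulgA.
- by rewrite -[r]mulg1 fr mulgK.
by rewrite -[l]mulg1 fl mulgK.
Qed.

Lemma rotary_pairV (gT : finGroupType) (r l : gT) :
  rotary_pair r l -> rotary_pair r^-1 l.
Proof.
move=> [ol genG]; split=> //; apply/eqP; rewrite eqEsubset subsetT /= -genG gen_subG.
by rewrite subUset !sub1set -groupV !mem_gen ?set21 ?set22.
Qed.

Lemma mirror_cayley (gT : finGroupType) (r l : gT) (P : rotary_pair r l) :
  orient_iso (map_mirror (cayley_map P)) (cayley_map (rotary_pairV P)).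
Proof.
exists id; split=> [|x|x] //=; first by exists id.
by rewrite lmulV lmulE.
Qed.

(** The arcs are parametrised by the group through the images of a base arc. *)
Lemma regular_cayley (gT : finGroupType) (N : oriented_map) :
    orientably_regular N -> AutP N \isog [set: gT] ->
  exists (r l : gT) (P : rotary_pair r l), orient_iso (cayley_map P) N.
Proof.
move=> [trA freeA]; rewrite isog_sym => /isogP[f injf imf].
have /imsetP[x0 _ _] := omap_conn N.
pose F (g : gT) := f g x0.
have Af g : f g \in AutP N by rewrite -imf mem_morphim ?inE.
have fM g h y : f (g * h) y = f h (f g y) by rewrite morphM ?inE // permM.
have frot g y : f g (dart_rot N y) = dart_rot N (f g y).
  have /centP/(_ (dart_rot N)) := Af g; rewrite set21 => /(_ isT) /permP/(_ y).
  by rewrite !permM.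
have frev g y : f g (dart_rev N y) = dart_rev N (f g y).
  have /centP/(_ (dart_rev N)) := Af g; rewrite set22 => /(_ isT) /permP/(_ y).
  by rewrite !permM.
have F_inj : injective F.
  move=> g h eqF; apply/eqP; rewrite -(inj_eq (mulIg h^-1)) mulgV; apply/eqP.
  apply: (injmP injf); rewrite ?inE // morph1; apply/set1gP.
  rewrite -(freeA x0) inE Af; apply/astab1P.
  by rewrite /= apermE fM -/(F g) eqF -fM mulgV morph1 perm1.
have F_sur y : exists g, F g = y.
  have [a Aa ->] := atransP2 trA (in_setT x0) (in_setT y).
  have /morphimP[g _ _ ->] : a \in f @* [set: gT] by rewrite imf.
  by exists g.
have [r Fr] := F_sur (dart_rot N x0).
have [l Fl] := F_sur (dart_rev N x0).
have FrM g : F (r * g) = dart_rot N (F g) by rewrite /F fM -/(F r) Fr frot.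
have FlM g : F (l * g) = dart_rev N (F g) by rewrite /F fM -/(F l) Fl frev.
have F1 : F 1 = x0 by rewrite /F morph1 perm1.
have P : rotary_pair r l.
  split.
    apply: nt_prime_order => //.
      by apply: F_inj; rewrite expg2 FlM Fl dart_revK F1.
    by apply/eqP=> l1; move/eqP: Fl; rewrite l1 F1 eq_sym (negPf (dart_rev_neq x0)).
  apply/eqP; rewrite eqEsubset subsetT /=; apply/subsetP=> g _.
  (* The arcs reached by the subgroup of r and l are closed under rotation and
     reversal, so by connectedness they are all the arcs. *)
  pose K := F @: <<[set r; l]>>.
  suff /imsetP[h Kh /F_inj->] : F g \in K by [].
  have Kx0 : x0 \in K by apply/imsetP; exists 1; rewrite // group1.
  have actK : [acts <<[set dart_rot N; dart_rev N]>>, on K | 'P].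
    rewrite gen_subG; apply/subsetP=> a; rewrite !inE => Ha.
    apply/subsetP=> _ /imsetP[h Kh ->]; rewrite inE /= apermE.
    case/orP: Ha => /eqP->; rewrite -?FrM -?FlM; apply: imset_f;
      by rewrite groupM // mem_gen // ?set21 ?set22.
  have [a Ga ->] := atransP2 (omap_conn N) (in_setT x0) (in_setT (F g)).
  by rewrite (acts_act actK).
exists r, l, P, F; split=> [|g|g] /=.
- by apply: inj_card_bij => //; apply: (leq_trans _ (leq_image_card F predT));
    rewrite -cardsT subset_leq_card //; apply/subsetP=> y _;
    have [g <-] := F_sur y; apply: image_f.
- by rewrite lmulE FrM.
by rewrite lmulE FlM.
Qed.

(** The face relation transfers along an isomorphism of maps, so the order
    of r^-1 l divides the face size of [N]. *)
Lemma iso_face_order (gT : finGroupType) (r l : gT) (P : rotary_pair r l)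
    (N : oriented_map) m k :
  orient_iso (cayley_map P) N -> has_type N m k -> (r^-1 * l) ^+ m = 1.
Proof.
move=> [F [bF Fr Fl]] [typeN _].
have Ff x : F ((r^-1 * l) * x) = dart_face N (F x).
  rewrite /dart_face permM; apply: (@perm_inj _ (dart_rot N)).
  by rewrite permKV -Fl -Fr /= !lmulE !mulgA mulgV mul1g.
apply: (bij_inj bF); rewrite -[_ ^+ m]mulg1.
have -> n : F ((r^-1 * l) ^+ n * 1) = iter n (dart_face N) (F 1).
  by elim: n => [|n IHn]; rewrite ?mul1g // expgS -mulgA Ff IHn.
by rewrite -(typeN (porbit (dart_face N) (F 1))) ?iter_porbit // imset_f.
Qed.

(** * The semidirect product of the plane with Z/10 *)

Section AffineGroup.

Variable F : finFieldType.
Implicit Types la mu : {x : F | (x ^+ 10 == 1)%R}.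

Lemma unity_exprD la (i j : 'Z_10) :
  (sval la ^+ (i + j)%R = sval la ^+ i * sval la ^+ j)%R.
Proof. by rewrite -exprD expr_mod //; apply/eqP/(svalP la). Qed.

Lemma unity_exprMn la (i : 'Z_10) n :
  (sval la ^+ (i *+ n)%R = (sval la ^+ i) ^+ n)%R.
Proof.
by elim: n => [|n IHn]; rewrite ?expr0 // mulrS exprS unity_exprD IHn.
Qed.

Lemma unity_expr_neq0 la n : (sval la ^+ n != 0)%R.
Proof.
rewrite expf_neq0 //; apply: contraTneq (svalP la) => ->.
by rewrite expr0n /= eq_sym oner_eq0.
Qed.

Lemma unity_exprN la (i : 'Z_10) : (sval la ^+ (- i)%R = (sval la ^+ i)^-1)%R.
Proof.
apply: (mulfI (unity_expr_neq0 la i)).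
by rewrite -unity_exprD subrr mulfV // unity_expr_neq0.
Qed.

(** The semidirect product in which the generator of Z/10 acts on the plane over
    F as diag(la, mu).  The equation in the types of la and mu is what makes the
    action well defined; the type is an alias so that it does not inherit the
    direct product structure of the triples. *)
Definition twisted la mu : Type := (F * F * 'Z_10)%type.

HB.instance Definition _ la mu := Finite.on (twisted la mu).

Definition tw {la mu} (u v : F) (i : 'Z_10) : twisted la mu := (u, v, i).
Global Arguments tw {la mu} (u v i)%_ring_scope.
Definition fst_coord {la mu} (g : twisted la mu) : F := g.1.1.
Definition snd_coord {la mu} (g : twisted la mu) : F := g.1.2.
Definition rot_part {la mu} (g : twisted la mu) : 'Z_10 := g.2.

Definition tw_mul la mu (g h : twisted la mu) : twisted la mu :=
  tw (fst_coord g + sval la ^+ rot_part g * fst_coord h)%R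
     (snd_coord g + sval mu ^+ rot_part g * snd_coord h)%R
     (rot_part g + rot_part h)%R.

Definition tw_inv la mu (g : twisted la mu) : twisted la mu :=
  tw (- ((sval la ^+ rot_part g)^-1 * fst_coord g))%R
     (- ((sval mu ^+ rot_part g)^-1 * snd_coord g))%R
     (- rot_part g)%R.

Lemma tw_mulA la mu : associative (@tw_mul la mu).
Proof.
by case=> [[u v] i] [[u' v'] i'] [[u'' v''] i'']; rewrite /tw_mul /tw;
  congr (_, _, _); rewrite /= ?unity_exprD ?mulrDr ?mulrA ?addrA.
Qed.

Lemma tw_mul1 la mu : left_id (tw 0 0 0)%R (@tw_mul la mu).
Proof.
by case=> [[u v] i]; rewrite /tw_mul /tw /=; congr (_, _, _);
  rewrite /= ?expr0 ?mul1r ?add0r.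
Qed.

Lemma tw_mulV la mu : left_inverse (tw 0 0 0)%R (@tw_inv la mu) (@tw_mul la mu).
Proof.
by case=> [[u v] i]; rewrite /tw_mul /tw_inv /tw /=; congr (_, _, _);
  rewrite /= ?unity_exprN ?addNr.
Qed.

HB.instance Definition _ la mu :=
  Finite_isGroup.Build (twisted la mu)
    (@tw_mulA la mu) (@tw_mul1 la mu) (@tw_mulV la mu).

Section Theory.

Variables la mu : {x : F | (x ^+ 10 == 1)%R}.
Local Notation Gam := (twisted la mu).
Implicit Types (g h : Gam).

Lemma twM u v i u' v' i' :
  tw u v i * tw u' v' i' =
  tw (u + sval la ^+ i * u')%R (v + sval mu ^+ i * v')%R (i + i')%R :> Gam.
Proof. by []. Qed.

Lemma twV u v i :
  (tw u v i)^-1 =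
  tw (- ((sval la ^+ i)^-1 * u))%R (- ((sval mu ^+ i)^-1 * v))%R (- i)%R :> Gam.
Proof. by []. Qed.

Lemma fst_tw u v i : fst_coord (tw u v i : Gam) = u. Proof. by []. Qed.
Lemma snd_tw u v i : snd_coord (tw u v i : Gam) = v. Proof. by []. Qed.
Lemma rot_tw u v i : rot_part (tw u v i : Gam) = i. Proof. by []. Qed.

Lemma tw_ind (P : Gam -> Prop) : (forall u v i, P (tw u v i)) -> forall g, P g.
Proof. by move=> Ptw [[u v] i]; apply: Ptw. Qed.

Lemma tw_inj u v i u' v' i' :
  tw u v i = tw u' v' i' :> Gam -> [/\ u = u', v = v' & i = i'].
Proof. by case. Qed.

Lemma rot_partM : {morph @rot_part la mu : g h / g * h >-> (g + h)%R}.
Proof. by []. Qed.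

Lemma rot_partX n : {morph @rot_part la mu : g / g ^+ n >-> (g *+ n)%R}.
Proof. by elim: n => [|n IHn] g //; rewrite expgS mulrS rot_partM IHn. Qed.

Lemma rot_partV : {morph @rot_part la mu : g / g^-1 >-> (- g)%R}.
Proof. by []. Qed.

(** An affine map with a fixed point is a conjugate of a linear one: the powers
    of an element fixing (e, f) fix (e, f). *)
Lemma twX_fixed (e f : F) (i : 'Z_10) n :
  tw (e * (1 - sval la ^+ i)) (f * (1 - sval mu ^+ i)) i ^+ n =
  tw (e * (1 - sval la ^+ (i *+ n)%R)) (f * (1 - sval mu ^+ (i *+ n)%R)) (i *+ n)%R
  :> Gam.
Proof.
elim: n => [|n IHn]; first by rewrite mulr0n !expr0 subrr !mulr0.
rewrite expgS IHn twM mulrS; congr tw; rewrite unity_exprD; ring.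
Qed.

End Theory.
End AffineGroup.

(** * Generating pairs up to automorphism *)

Lemma Z10_two_torsion (i : 'Z_10) : (i *+ 2 = 0 -> i != 0 -> i = 5%:R)%R.
Proof. by move=> /eqP i2 i0; apply/eqP; case: i i2 i0; do 10! [case=> [//|]]. Qed.

Lemma Z10_unit (i : 'Z_10) :
  ((- i + 5%:R) *+ 5 = 0 -> i != 5%:R -> i \is a GRing.unit)%R.
Proof. by move/eqP; case: i; do 10! [case=> [//|]]. Qed.

Section Aut.

Variables (F : finFieldType) (la mu : {x : F | (x ^+ 10 == 1)%R}).
Local Notation Gam := (twisted la mu).
Hypothesis la_prim : (10.-primitive_root (sval la))%R.
Hypothesis mu_prim : (10.-primitive_root (sval mu))%R.

(** Conjugation by the affine map z |-> diag(x, y) z + (e, f) of the plane. *)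
Definition affine_conj (x y e f : F) (g : Gam) : Gam :=
  tw (x * fst_coord g + e * (1 - sval la ^+ rot_part g))
     (y * snd_coord g + f * (1 - sval mu ^+ rot_part g)) (rot_part g).

Lemma affine_conjM x y e f : {morph affine_conj x y e f : g h / g * h}.
Proof.
elim/tw_ind=> u v i; elim/tw_ind=> u' v' i'.
by rewrite twM /affine_conj /= twM /fst_coord /snd_coord /rot_part /=;
  congr tw; rewrite unity_exprD; ring.
Qed.

Lemma affine_conj_bij x y e f :
  x != 0%R -> y != 0%R -> bijective (affine_conj x y e f).
Proof.
move=> x0 y0; apply: injF_bij; elim/tw_ind=> u v i; elim/tw_ind=> u' v' i'.
rewrite /affine_conj /fst_coord /snd_coord /rot_part /= => /tw_inj[equ eqv eqi].
rewrite -eqi in equ eqv *.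
by have -> := mulfI x0 (addIr _ equ); have -> := mulfI y0 (addIr _ eqv).
Qed.

Lemma prim10_expr_eq1 (x : F) (i : 'Z_10) :
  (10.-primitive_root x)%R -> (x ^+ i == 1)%R = (i == 0%R).
Proof.
by move=> x_prim; rewrite -(prim_order_dvd x_prim) /dvdn modn_small // ltn_ord.
Qed.

Lemma prim10_expr_inj (x : F) (i j : 'Z_10) :
  (10.-primitive_root x)%R -> (x ^+ i = x ^+ j)%R -> i = j.
Proof.
move=> x_prim /eqP; rewrite (eq_prim_root_expr x_prim) !modn_small ?ltn_ord //.
by move/eqP/val_inj.
Qed.

Lemma prim10_expr5 (x : F) : (10.-primitive_root x)%R -> (x ^+ 5 = -1)%R.
Proof.
move=> x_prim; have: ((x ^+ 5) ^+ 2 == 1)%R by rewrite -exprM (prim_expr_order x_prim).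
rewrite -subr_eq0 subr_sqr_1 mulf_eq0 subr_eq0 addr_eq0 => /orP[x5|/eqP//].
by have := prim_order_dvd x_prim 5; rewrite x5.
Qed.

Lemma two_neq0 : (1 + 1 != 0 :> F)%R.
Proof.
rewrite addr_eq0 -(prim10_expr5 la_prim) eq_sym.
by rewrite (prim10_expr_eq1 (5%:R : 'Z_10)%R la_prim).
Qed.

(** Since la and mu are primitive, a nontrivial rotation part has no eigenvalue 1,
    hence a fixed point. *)
Lemma tw_fixed (g : Gam) : rot_part g != 0%R -> exists e f,
  g = tw (e * (1 - sval la ^+ rot_part g)) (f * (1 - sval mu ^+ rot_part g))
         (rot_part g).
Proof.
elim/tw_ind: g => u v i; rewrite /rot_part /= => i0.
exists (u / (1 - sval la ^+ i))%R, (v / (1 - sval mu ^+ i))%R.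
by rewrite !divfK // subr_eq0 eq_sym prim10_expr_eq1.
Qed.

Lemma twisted_expg_eq1 (g : Gam) n :
  rot_part g != 0%R -> (g ^+ n == 1) = (rot_part g *+ n == 0)%R.
Proof.
move=> g0; apply/eqP/eqP => [gn|gn]; first by rewrite -rot_partX gn.
have [e [f ->]] := tw_fixed g0.
by rewrite twX_fixed gn !expr0 subrr !mulr0.
Qed.

(** The translations have odd order, so the involutions lie over the element of
    order 2 of Z/10. *)
Lemma rot_part_involution (g : Gam) : #[g] = 2 -> rot_part g = 5%:R%R.
Proof.
move=> og; have g2 : g ^+ 2 = 1 by rewrite -og expg_order.
have [g0 | g0] := eqVneq (rot_part g) 0%R; last first.
  by apply: Z10_two_torsion => //; rewrite -rot_partX g2.
have : g != 1 by rewrite -order_eq1 og.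
case/eqP; move: g2; move: g g0 {og}; elim/tw_ind=> u v i; rewrite {1}/rot_part /= => ->.
rewrite expgS expg1 twM !expr0 !mul1r => /tw_inj [u2 v2 _].
have half (x : F) : (x + x = 0 -> x = 0)%R.
  by move=> xx; apply: (mulfI two_neq0); rewrite mulrDl !mul1r mulr0.
by rewrite (half u u2) (half v v2).
Qed.

Section Pair.

Variables r l : Gam.
Hypothesis rlP : rotary_pair r l.

(** Otherwise the pair would generate a group over the subgroup {0, 5}. *)
Lemma rotary_rot_part_neq : ~ (rot_part r = 5%:R%R \/ rot_part r = 0%R).
Proof.
move=> r5; suff H (g : Gam) : rot_part g = 5%:R%R \/ rot_part g = 0%R.
  by case: (H (tw 0 0 1)).
move: g; apply: (rotary_ind rlP) => [|g|g]; first by right.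
  by rewrite rot_partM; case: r5 => -> [] ->; [right|left|left|right]; apply/val_inj.
by rewrite rot_partM (rot_part_involution rlP.1) => -[] ->; [right | left]; apply/val_inj.
Qed.

(** Writing k for the rotation part of r, the relation gives 5 (5 - k) = 0 in
    Z/10, so k is odd; and 5 is the only odd element of Z/10 which is not a
    unit. *)
Lemma rotary_rot_part_unit :
  (r^-1 * l) ^+ 5 = 1 -> rot_part r \is a GRing.unit.
Proof.
move=> face5; apply: Z10_unit; last by apply/eqP=> r5; case: rotary_rot_part_neq; left.
by rewrite -(rot_part_involution rlP.1) -rot_partV -rot_partM -rot_partX face5.
Qed.

(** A coordinate of the group is a cocycle; if its values at r and l come from the
    same point e, then so do all its values, as r and l generate.  In other
    words, e is then fixed by the whole group. *)
Lemma rotary_coboundary (z : {x : F | (x ^+ 10 == 1)%R}) (co : Gam -> F) (e : F) :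
  (forall g h : Gam, co (g * h) = (co g + sval z ^+ rot_part g * co h)%R) ->
  co r = (e * (1 - sval z ^+ rot_part r))%R ->
  co l = (e * (1 - sval z ^+ rot_part l))%R ->
  forall g, co g = (e * (1 - sval z ^+ rot_part g))%R.
Proof.
move=> coM co_r co_l.
have co1 : co 1 = 0%R.
  by apply: (addrI (co 1)); rewrite addr0 -{3}[1]mulg1 coM expr0 mul1r.
apply: (rotary_ind rlP) => [|g co_g|g co_g].
- by rewrite co1 expr0 subrr mulr0.
- by rewrite rot_partM unity_exprD coM co_r co_g; ring.
by rewrite rot_partM unity_exprD coM co_l co_g; ring.
Qed.

(** The involution l fixes a point (e, f), to be moved to the origin.  The
    position of r relative to this point has nonzero coordinates by
    [rotary_coboundary], so a diagonal matrix scales it to (1, 1). *)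
Lemma rotary_normal_form :
  exists phi : Gam -> Gam,
  [/\ bijective phi, {morph phi : g h / g * h},
      phi (tw 1 1 (rot_part r)) = r & phi (tw 0 0 5%:R) = l].
Proof.
have l5 := rot_part_involution rlP.1.
have [|e [f lE]] := tw_fixed (g := l); first by rewrite l5.
have gen1 : fst_coord r != (e * (1 - sval la ^+ rot_part r))%R.
  apply/eqP=> rE; have co_l : fst_coord l = (e * (1 - sval la ^+ rot_part l))%R.
    by rewrite {1}lE.
  have /eqP := rotary_coboundary (fun _ _ => erefl) rE co_l (tw 1 0 0).
  by rewrite expr0 subrr mulr0 oner_eq0.
have gen2 : snd_coord r != (f * (1 - sval mu ^+ rot_part r))%R.
  apply/eqP=> rE; have co_l : snd_coord l = (f * (1 - sval mu ^+ rot_part l))%R.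
    by rewrite {1}lE.
  have /eqP := rotary_coboundary (fun _ _ => erefl) rE co_l (tw 0 1 0).
  by rewrite expr0 subrr mulr0 oner_eq0.
rewrite l5 in lE.
rewrite -subr_eq0 in gen1; rewrite -subr_eq0 in gen2.
exists (affine_conj (fst_coord r - e * (1 - sval la ^+ rot_part r))%R
                    (snd_coord r - f * (1 - sval mu ^+ rot_part r))%R e f); split.
- exact: affine_conj_bij gen1 gen2.
- exact: affine_conjM.
- by rewrite /affine_conj /= !mulr1 !subrK; case: (r) => [[u v] i].
by rewrite /affine_conj /fst_coord /snd_coord /= !mulr0 !add0r lE.
Qed.

End Pair.
End Aut.

(** * Invariance of the rotation part, and the standard pairs *)

(** The rules computing a product of explicit elements. *)
Definition twE := (fst_tw, snd_tw, rot_tw, twM, expr0, expr1, mul1r, mulr0, mulr1,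
  mul0r, addr0, add0r).

Section PrimeField.

Variables (p : nat) (la mu : {x : 'F_p | (x ^+ 10 == 1)%R}).
Local Notation Gam := (twisted la mu).
Hypothesis la_prim : (10.-primitive_root (sval la))%R.
Hypothesis mu_prim : (10.-primitive_root (sval mu))%R.

Lemma trans_expg (u v : 'F_p) n : tw u v 0 ^+ n = tw (u *+ n) (v *+ n) 0 :> Gam.
Proof.
elim: n => [|n IHn]; first by rewrite !mulr0n.
by rewrite expgS IHn !twE !mulrS.
Qed.

Lemma trans_expg_Fp (u v x : 'F_p) : tw u v 0 ^+ x = tw (u * x) (v * x) 0 :> Gam.
Proof. by rewrite trans_expg -(mulr_natr u) -(mulr_natr v) natr_Zp. Qed.

Lemma rot_expg (n : nat) : tw 0 0 1 ^+ n = tw 0 0 n%:R :> Gam.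
Proof.
elim: n => [|n IHn]; first by [].
by rewrite expgS IHn !twE mulrS.
Qed.

Lemma tw_decomp (u v : 'F_p) (i : 'Z_10) :
  tw u v i = tw 1 0 0 ^+ u * tw 0 1 0 ^+ v * tw 0 0 1 ^+ i :> Gam.
Proof.
by rewrite !trans_expg_Fp rot_expg natr_Zp !twE.
Qed.

Section Automorphism.

Hypothesis no_swap :
  forall i : 'Z_10, (sval la ^+ i = sval mu -> sval mu ^+ i = sval la -> False)%R.
Variable phi : Gam -> Gam.
Hypotheses (phi_inj : injective phi) (phiM : {morph phi : g h / g * h}).

Let phi1 : phi 1 = 1.
Proof. by apply: (mulgI (phi 1)); rewrite -phiM !mulg1. Qed.

Let phiX g n : phi (g ^+ n) = phi g ^+ n.
Proof. by elim: n => [|n IHn]; rewrite ?phi1 // !expgS phiM IHn. Qed.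

(** Every translation is a commutator, and Z/10 is abelian. *)
Lemma rot_part_morph_trans u v : rot_part (phi (tw u v 0)) = 0%R.
Proof.
pose x : Gam := tw (u / (sval la - 1)) (v / (sval mu - 1)) 0.
have neq0 (z : 'F_p) : (10.-primitive_root z -> z - 1 != 0)%R.
  by move=> z_prim; rewrite subr_eq0 -[z]expr1 (prim10_expr_eq1 1%R z_prim).
have comm_tx : tw 0 0 1 * x = tw u v 0 * x * tw 0 0 1.
  rewrite /x !twE; congr tw.
    by rewrite -{2}[u](divfK (neq0 _ la_prim)); ring.
  by rewrite -{2}[v](divfK (neq0 _ mu_prim)); ring.
have := congr1 (fun g => rot_part (phi g)) comm_tx.
rewrite /= !phiM !rot_partM addrC => /addIr.
by rewrite -[LHS]add0r => /addIr.
Qed.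

(** Let phi(t) lie over i, and let phi send the unit translations a, b to the
    translations (x, y), (x', y').  Applying phi to t a t^-1 = a^la and
    t b t^-1 = b^mu gives la^i x = la x, mu^i y = la y, la^i x' = mu x' and
    mu^i y' = mu y'.  If x or y' is nonzero then i = 1; otherwise y and x' are
    nonzero and i would exchange la and mu. *)
Lemma rot_part_aut g : rot_part (phi g) = rot_part g.
Proof.
set i := rot_part (phi (tw 0 0 1)).
have transP u v : exists x y, phi (tw u v 0) = tw x y 0.
  have := rot_part_morph_trans u v; case: (phi _) => [[x y] j] /= j0.
  by exists x, y; rewrite -j0.
have [x [y phi_a]] := transP 1%R 0%R.
have [x' [y' phi_b]] := transP 0%R 1%R.
have phi_t :
    phi (tw 0 0 1) = tw (fst_coord (phi (tw 0 0 1))) (snd_coord (phi (tw 0 0 1))) i.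
  by rewrite /i; case: (phi _) => [[? ?] ?].
have rel_a : tw 0 0 1 * tw 1 0 0 = tw 1 0 0 ^+ sval la * tw 0 0 1 :> Gam.
  by rewrite trans_expg_Fp !twE.
have rel_b : tw 0 0 1 * tw 0 1 0 = tw 0 1 0 ^+ sval mu * tw 0 0 1 :> Gam.
  by rewrite trans_expg_Fp !twE.
have := congr1 phi rel_a; have := congr1 phi rel_b.
rewrite !phiM !phiX phi_a phi_b phi_t !trans_expg_Fp !twE.
case/tw_inj; rewrite ![(_ + fst_coord _)%R]addrC ![(_ + snd_coord _)%R]addrC.
move=> /addrI lx' /addrI my' _; case/tw_inj=> /addrI lx /addrI my _.
suff i1 : i = 1%R.
  elim/tw_ind: g => u v j; have -> : tw u v j = tw u v 0 * tw 0 0 1 ^+ j :> Gam.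
    by rewrite rot_expg natr_Zp twM !twE.
  by rewrite phiM phiX !rot_partM rot_part_morph_trans !rot_partX -/i i1.
have [x0 | x_neq0] := eqVneq x 0%R; last first.
  apply: (prim10_expr_inj la_prim); apply: (mulIf x_neq0).
  by rewrite lx expr1 mulrC.
have [y'0 | y'_neq0] := eqVneq y' 0%R; last first.
  apply: (prim10_expr_inj mu_prim); apply: (mulIf y'_neq0).
  by rewrite my' expr1 mulrC.
have y_neq0 : y != 0%R.
  apply/eqP=> y0; have /phi_inj/tw_inj[/eqP] : phi (tw 1 0 0) = phi 1.
    by rewrite phi1 phi_a x0 y0.
  by rewrite oner_eq0.
have x'_neq0 : x' != 0%R.
  apply/eqP=> x'0; have /phi_inj/tw_inj[_ /eqP] : phi (tw 0 1 0) = phi 1.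
    by rewrite phi1 phi_b x'0 y'0.
  by rewrite oner_eq0.
case: (no_swap (i := i)).
  by apply: (mulIf x'_neq0); rewrite lx' mulrC.
by apply: (mulIf y_neq0); rewrite my mulrC.
Qed.

End Automorphism.

Section StandardPair.

Hypothesis la_neq_mu : sval la != sval mu.
Variable k : 'Z_10.
Hypothesis k_unit : k \is a GRing.unit.

Let r : Gam := tw 1 1 k.
Let l : Gam := tw 0 0 5%:R.

Lemma expr_unit_neq : (sval la ^+ k != sval mu ^+ k)%R.
Proof.
apply: contraNneq la_neq_mu => eqk.
have k1 : (k *+ (k^-1 : 'Z_10) = 1)%R by rewrite -mulr_natr natr_Zp divrr.
have := congr1 (fun x => x ^+ (k^-1 : 'Z_10))%R eqk.
by rewrite -!unity_exprMn k1 !expr1 => ->.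
Qed.

(** The commutator l r l^-1 r^-1 is the translation by (-2, -2).  Its conjugate by
    r is a translation in another direction, as the k-th powers of la and mu
    differ; combining the two yields the translations along both axes, and a
    power of r over 1 then yields the rest. *)
Lemma standard_rotary : rotary_pair r l.
Proof.
have la5 := prim10_expr5 la_prim; have mu5 := prim10_expr5 mu_prim.
have two0 := two_neq0 la_prim.
have Z5 : (5%:R : 'Z_10)%R != 0%R by [].
split.
  apply: nt_prime_order => //.
  by apply/eqP; rewrite (twisted_expg_eq1 la_prim mu_prim).
apply/eqP; rewrite eqEsubset subsetT /=; apply/subsetP=> g _.
set K := <<_>>; have Kr : r \in K by rewrite mem_gen ?set21.
have Kl : l \in K by rewrite mem_gen ?set22.
pose n : Gam := tw (- 2%:R) (- 2%:R) 0.
have Kn : n \in K.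
  have -> : n = l * r * (r * l)^-1; last by rewrite !groupM ?groupV ?groupM.
  apply: (canRL (mulgK _)); rewrite /n /r /l !twE [(5%:R + _)%R]addrC.
  by rewrite la5 mu5; congr tw; ring.
have Kconj : r * n * r^-1 \in K by rewrite !groupM ?groupV.
have conjE : r * n * r^-1 = tw (- (2%:R * sval la ^+ k)) (- (2%:R * sval mu ^+ k)) 0.
  by apply/(canLR (mulgK _)); rewrite !twE; congr tw; ring.
have KE (x : 'F_p) : tw (2%:R * (x - sval la ^+ k)) (2%:R * (x - sval mu ^+ k)) 0 \in K.
  have : (n ^+ x)^-1 * (r * n * r^-1) \in K by rewrite groupM ?groupV ?groupX.
  rewrite conjE trans_expg_Fp twV twM oppr0 !expr0 !invr1 !twE.
  by congr (tw _ _ _ \in K); ring.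
have Kfst (u : 'F_p) : tw u 0 0 \in K.
  have := groupX (u / (2%:R * (sval mu ^+ k - sval la ^+ k)))%R (KE (sval mu ^+ k)%R).
  rewrite trans_expg_Fp subrr mulr0 mul0r mulrC divfK //.
  by rewrite mulf_neq0 // subr_eq0 eq_sym expr_unit_neq.
have Ksnd (v : 'F_p) : tw 0 v 0 \in K.
  have := groupX (v / (2%:R * (sval la ^+ k - sval mu ^+ k)))%R (KE (sval la ^+ k)%R).
  rewrite trans_expg_Fp subrr mulr0 mul0r mulrC divfK //.
  by rewrite mulf_neq0 // subr_eq0 expr_unit_neq.
have Kt : tw 0 0 1 \in K.
  have := groupX (k^-1)%R Kr.
  have -> : r ^+ (k^-1)%R =
      tw (fst_coord (r ^+ (k^-1)%R)) 0 0 * tw 0 (snd_coord (r ^+ (k^-1)%R)) 0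
      * tw 0 0 1.
    have : rot_part (r ^+ (k^-1)%R) = 1%R.
      by rewrite rot_partX -mulr_natr natr_Zp divrr.
    case: (r ^+ _) => [[u v] j] /= ->.
    by rewrite !twE.
  by rewrite groupMl // groupM.
elim/tw_ind: g => u v i.
by rewrite tw_decomp !groupM // groupX.
Qed.

Lemma order_standard_rot : #[r] = 10.
Proof.
have k_neq0 : k != 0%R by apply: contraTneq k_unit => ->.
have nk n : (k *+ n == 0)%R = (10 %| n).
  rewrite -mulr_natr -[X in (_ == X)%R](mulr0 k) (inj_eq (mulrI k_unit)).
  by rewrite -val_eqE /= val_Zp_nat.
apply/eqP; rewrite eqn_dvd order_dvdn !(twisted_expg_eq1 la_prim mu_prim) // nk dvdnn.
by have /eqP := expg_order r; rewrite (twisted_expg_eq1 la_prim mu_prim) // nk.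
Qed.

(** Here r^-1 l lies over 5 - k, which is even and nonzero as k is a unit. *)
Lemma order_standard_face : #[r^-1 * l] = 5.
Proof.
have rotE : rot_part (r^-1 * l) = (- k + 5%:R)%R by [].
have /andP[k0 /eqP k5] : ((- k + 5%:R != 0) && ((- k + 5%:R) *+ 5 == 0))%R.
  by move: k_unit; case: (k); do 10! [case=> [//|]].
apply: nt_prime_order => //.
  by apply/eqP; rewrite (twisted_expg_eq1 la_prim mu_prim) // rotE k5.
by apply/eqP=> /(congr1 (@rot_part _ _ _)); rewrite rotE; apply/eqP.
Qed.

End StandardPair.
End PrimeField.

(** * The presentation *)

Lemma expgD_Zp (gT : finGroupType) m (x : gT) (i j : 'I_m.+2) :
  x ^+ m.+2 = 1 -> x ^+ (i + j)%R = x ^+ i * x ^+ j.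
Proof. by move=> xm; rewrite -expgD /= expg_mod. Qed.

Lemma expgM_Zp (gT : finGroupType) m (x : gT) (i j : 'I_m.+2) :
  x ^+ m.+2 = 1 -> x ^+ (i * j)%R = x ^+ i ^+ j.
Proof. by move=> xm; rewrite -expgM /= expg_mod. Qed.

Lemma expgN_Zp (gT : finGroupType) m (x : gT) (i : 'I_m.+2) :
  x ^+ m.+2 = 1 -> x ^+ (- i)%R = (x ^+ i)^-1.
Proof. by move=> xm; apply: (mulgI (x ^+ i)); rewrite -expgD_Zp // subrr mulgV. Qed.

Section Presentation.

Variables (p : nat) (la mu : {x : 'F_p | (x ^+ 10 == 1)%R}).
Hypothesis p_prime : prime p.
Local Notation Gam := (twisted la mu).

Section Universal.

Variables (gT : finGroupType) (a b t : gT).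
Hypotheses (ap : a ^+ p = 1) (bp : b ^+ p = 1) (t10 : t ^+ 10 = 1).
Hypothesis ab : commute a b.
Hypotheses (ta : a ^ t^-1 = a ^+ sval la) (tb : b ^ t^-1 = b ^+ sval mu).

Lemma conj_expg (z : {x : 'F_p | (x ^+ 10 == 1)%R}) (x : gT) n (u : 'F_p) :
  x ^+ p = 1 -> x ^ t^-1 = x ^+ sval z ->
  (x ^+ u) ^ (t ^- n) = x ^+ (sval z ^+ n * u)%R.
Proof.
rewrite -{1}(Fp_cast p_prime) => xp tx; rewrite -expgVn.
elim: n u => [|n IHn] u; first by rewrite conjg1 expr0 mul1r.
rewrite expgSr conjgM IHn conjXg tx -expgM_Zp // exprS -!mulrA.
by congr (_ ^+ _).
Qed.

(** Universal property of the semidirect product: elements a, b, t satisfying its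
    defining relations define a morphism. *)
Lemma twisted_morphism : exists f : {morphism [set: Gam] >-> gT},
  [/\ f (tw 1 0 0) = a, f (tw 0 1 0) = b & f (tw 0 0 1) = t].
Proof.
pose f (g : Gam) := a ^+ fst_coord g * b ^+ snd_coord g * t ^+ rot_part g.
have ap' := ap; have bp' := bp; rewrite -(Fp_cast p_prime) in ap' bp'.
have fE u v i : f (tw u v i) = a ^+ u * b ^+ v * t ^+ i by [].
have fM : {in [set: Gam] &, {morph f : g h / g * h}}.
  elim/tw_ind=> u v i; elim/tw_ind=> u' v' i' _ _.
  rewrite twM !fE (expgD_Zp _ _ ap') (expgD_Zp _ _ bp') (expgD_Zp _ _ t10).
  rewrite -(conj_expg _ _ ap ta) -(conj_expg _ _ bp tb).
  have abc : commute (a ^+ u' ^ t ^- i) (b ^+ v).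
    by rewrite (conj_expg _ _ ap ta); apply: commuteX2.
  rewrite !conjgE invgK !mulgA mulgKV.
  rewrite -!mulgA; congr (_ * _); rewrite !mulgA; congr (_ * _).
  have := abc; rewrite conjgE invgK /commute !mulgA => ->.
  by rewrite !mulgKV.
exists (Morphism fM); rewrite /= /f /fst_coord /snd_coord /rot_part /=.
by rewrite !mulg1 !mul1g !expg1.
Qed.

End Universal.
End Presentation.

Section Relations.

Variables (gT : finGroupType) (p n1 n2 n3 n4 : nat).

Definition Ghat_rels (a b c d : gT) : Prop :=
  [/\ [/\ a ^+ p = 1, b ^+ p = 1, c ^+ 5 = 1 & d ^+ 2 = 1],
      [/\ commute a b, (d * a) ^+ 2 = 1 & (d * b) ^+ 2 = 1],
      c * a * c^-1 = a ^+ n1, c * b * c^-1 = b ^+ n2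
    & d * c * d = a ^+ n3 * b ^+ n4 * c].

(** The exponents are arbitrary numbers here, which prevents the computation of
    their values in F_p when the relations are unfolded. *)
Lemma homg_Ghat_relsP (H : {group gT}) :
  (H \homg Grp (a : b : c : d :
    a ^+ p = b ^+ p = 1, c ^+ 5 = d ^+ 2 = 1, [~ a, b] = 1,
    (d * a) ^+ 2 = (d * b) ^+ 2 = 1,
    c * a * c^-1 = a ^+ n1,
    c * b * c^-1 = b ^+ n2,
    d * c * d = a ^+ n3 * b ^+ n4 * c)) <->
  exists a b c d : gT,
    <[a]> <*> <[b]> <*> <[c]> <*> <[d]> = H /\ Ghat_rels a b c d.
Proof.
split.
  case/existsP=> [[[[a b] c] d]] /eqP[defH ap bp c5 d2 /eqP/commgP ab da db ca cb dc].
  by exists a, b, c, d.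
case=> a [b [c [d [defH [[ap bp c5 d2] [ab da db] ca cb dc]]]]].
apply/existsP; exists (a, b, c, d) => /=.
rewrite !xpair_eqE defH ap bp c5 d2 da db ca cb dc.
by rewrite !eqxx !andbT /=; apply/commgP.
Qed.

End Relations.

Section Ghat.

Variables (p : nat) (s : 'F_p).
Hypotheses (p_prime : prime p) (p_ge11 : 11 <= p).
Hypothesis s_prim : (5.-primitive_root s)%R.

Lemma Fp_two_neq0 : (2%:R != 0 :> 'F_p)%R.
Proof.
rewrite -(dvdn_pcharf (pchar_Fp p_prime)).
by apply: contraL p_ge11 => /dvdn_leq p_le2; rewrite -ltnNge (leq_ltn_trans (p_le2 _)).
Qed.

(** The order of -s divides 10; it does not divide 2, since s is not of order 2,
    nor 5, since (-s)^5 = -1. *)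
Lemma opp_prim : (10.-primitive_root (- s))%R.
Proof.
have s10 : ((- s) ^+ 10 = 1)%R.
  by rewrite exprNn -signr_odd mul1r (exprM s 5 2) (prim_expr_order s_prim) expr1n.
have [m m_prim m_dvd] := prim_order_exists (isT : 0 < 10) s10.
have [m2 m5] : [/\ ~~ (m %| 2) & ~~ (m %| 5)].
  rewrite !(prim_order_dvd m_prim); split.
    by rewrite sqrrN -(prim_order_dvd s_prim).
  rewrite exprNn (prim_expr_order s_prim) mulr1.
  rewrite -signr_odd /= expr1 -subr_eq0 -opprD oppr_eq0.
  exact: Fp_two_neq0.
move: m_prim; have: m \in divisors 10 by rewrite -dvdn_divisors.
have -> : divisors 10 = [:: 1; 2; 5; 10]%N by [].
by rewrite !inE => /or4P[] /eqP mE; rewrite mE in m2 m5 *.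
Qed.

Lemma opp_sqE : (- s ^+ 2 = (- s) ^+ 7)%R.
Proof.
rewrite exprNn -signr_odd /= expr1 mulN1r.
by rewrite -[7%N]/(5 + 2)%N exprD (prim_expr_order s_prim) mul1r.
Qed.

Lemma opp_sq_prim : (10.-primitive_root (- s ^+ 2))%R.
Proof.
by rewrite opp_sqE (prim_root_exp_coprime 7 opp_prim).
Qed.

Definition opp_root : {x : 'F_p | (x ^+ 10 == 1)%R} :=
  exist _ (- s)%R (introT eqP (prim_expr_order opp_prim)).
Definition opp_sq_root : {x : 'F_p | (x ^+ 10 == 1)%R} :=
  exist _ (- s ^+ 2)%R (introT eqP (prim_expr_order opp_sq_prim)).

Lemma opp_root_prim : (10.-primitive_root (sval opp_root))%R.
Proof. exact: opp_prim. Qed.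

Lemma opp_sq_root_prim : (10.-primitive_root (sval opp_sq_root))%R.
Proof. exact: opp_sq_prim. Qed.

Local Notation Ghat := (twisted opp_root opp_sq_root).

(** The first equation forces i = 7, and 7 * 7 is not 1 modulo 10. *)
Lemma opp_no_swap (i : 'Z_10) :
  ((- s) ^+ i = - s ^+ 2 -> (- s ^+ 2) ^+ i = - s -> False)%R.
Proof.
rewrite opp_sqE => i7; have {i7} -> : i = 7%:R%R by apply: (prim10_expr_inj opp_prim).
rewrite -exprM -[RHS]expr1 => /eqP.
by rewrite (eq_prim_root_expr opp_prim).
Qed.

Lemma opp_neq_sq : (- s != - s ^+ 2)%R.
Proof.
by rewrite eqr_opp -{1}[s]expr1 (eq_prim_root_expr s_prim).
Qed.

Lemma card_Ghat : #|[set: Ghat]| = (10 * p ^ 2)%N.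
Proof.
rewrite cardsT /twisted !card_prod !card_ord (Fp_cast p_prime).
by rewrite mulnC mulnn.
Qed.

(** The generators of the presentation are the unit translations, diag(s, s^2)
    and the point reflection fixing the middle of (0, 0) and (1, 1). *)
Lemma Ghat_gens : exists a b c d : Ghat,
  <[a]> <*> <[b]> <*> <[c]> <*> <[d]> = [set: Ghat]
  /\ Ghat_rels p s (s ^+ 2)%R (1 - s)%R (1 - s ^+ 2)%R a b c d.
Proof.
pose a : Ghat := tw 1 0 0; pose b : Ghat := tw 0 1 0.
pose c : Ghat := tw 0 0 6%:R; pose d : Ghat := tw 1 1 5%:R.
have la5 : (sval opp_root ^+ (5%:R : 'Z_10) = - 1)%R := prim10_expr5 opp_root_prim.
have mu5 : (sval opp_sq_root ^+ (5%:R : 'Z_10) = - 1)%R := prim10_expr5 opp_sq_root_prim.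
have Z6 : (6%:R = 5%:R + 1 :> 'Z_10)%R by apply/val_inj.
have la6 : (sval opp_root ^+ (6%:R : 'Z_10) = s)%R.
  by rewrite Z6 unity_exprD la5 expr1 mulN1r opprK.
have mu6 : (sval opp_sq_root ^+ (6%:R : 'Z_10) = s ^+ 2)%R.
  by rewrite Z6 unity_exprD mu5 expr1 mulN1r opprK.
have xp (x : 'F_p) : (x *+ p = 0)%R by rewrite -mulr_natr pchar_Fp_0 ?mulr0.
exists a, b, c, d; split.
  apply/eqP; rewrite eqEsubset subsetT /=; apply/subsetP=> g _; set K := _ <*> _.
  have := subxx K; rewrite {1}/K !join_subG !cycle_subG -!andbA => /and4P[Ka Kb Kc Kd].
  have Kt : tw 0 0 1 \in K.
    have -> : tw 0 0 1 = (a * b)^-1 * d * c; last by rewrite !groupM ?groupV ?groupM.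
    rewrite -mulgA; apply: (canRL (mulKg _)); rewrite /a /b /c /d !twE.
    by congr tw; apply/val_inj.
  by elim/tw_ind: g => u v i; rewrite tw_decomp !groupM // groupX.
split.
- split; first by rewrite trans_expg !xp.
  + by rewrite trans_expg !xp.
  + by apply/eqP; rewrite (twisted_expg_eq1 opp_root_prim opp_sq_root_prim).
  by apply/eqP; rewrite (twisted_expg_eq1 opp_root_prim opp_sq_root_prim).
- rewrite /a /b /d; split; first by rewrite /commute !twE.
    by rewrite !twE expgS expg1 !twE la5 mu5; congr tw; [ring | ring | apply/val_inj].
  by rewrite !twE expgS expg1 !twE la5 mu5; congr tw; [ring | ring | apply/val_inj].
- by apply: (canLR (mulgK _)); rewrite /a /c trans_expg_Fp !twE la6.
- by apply: (canLR (mulgK _)); rewrite /b /c trans_expg_Fp !twE mu6.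
rewrite /a /b /c /d !trans_expg_Fp !twE.
by congr tw; apply/val_inj.
Qed.

Section Rels_homg.

Variables (gT : finGroupType) (H : {group gT}) (a b c d : gT).
Hypothesis genH : <[a]> <*> <[b]> <*> <[c]> <*> <[d]> = H.
Hypothesis relH : Ghat_rels p s (s ^+ 2)%R (1 - s)%R (1 - s ^+ 2)%R a b c d.

(** The relations of the presentation imply those of the semidirect product: e
    plays the point reflection about the origin, it commutes with c, and t = e c
    satisfies t^5 = e and t^6 = c. *)
Lemma homg_Ghat : H \homg [set: Ghat].
Proof.
case: relH => [[ap bp c5 d2] [ab da db] ca cb dc].
have [ap' bp'] : a ^+ (Zp_trunc (pdiv p)).+2 = 1 /\ b ^+ (Zp_trunc (pdiv p)).+2 = 1.
  by rewrite (Fp_cast p_prime).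
have dV : d^-1 = d by apply: (mulgI d); rewrite mulgV -expg2.
have ad : a ^ d = a^-1.
  by apply: (mulIg a); rewrite conjgE dV mulVg -da expg2 !mulgA.
have bd : b ^ d = b^-1.
  by apply: (mulIg b); rewrite conjgE dV mulVg -db expg2 !mulgA.
pose e := a^-1 * b^-1 * d.
have e2 : e ^+ 2 = 1.
  have -> : e ^+ 2 = a^-1 * b^-1 * (a^-1 * b^-1) ^ d.
    by rewrite expg2 conjgE dV /e !mulgA.
  by rewrite conjMg !conjVg ad bd !invgK -mulgA ab mulKg mulVg.
have eV : e^-1 = e by apply: (mulgI e); rewrite mulgV -expg2.
have fix_conj (x y : gT) : commute x y -> x ^ y = x.
  by move=> xy; rewrite conjgE xy mulKg.
have conj_a : (a ^ a^-1) ^ b^-1 = a.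
  by rewrite (fix_conj a a^-1); [apply/fix_conj/commuteV | apply/commuteV].
have conj_b : (b ^ a^-1) ^ b^-1 = b.
  by rewrite (fix_conj b a^-1); [apply/fix_conj/commuteV | apply/commuteV/commute_sym].
have ec : commute e c.
  have dcE : d * c = a ^+ (1 - s)%R * b ^+ (1 - s ^+ 2)%R * c * d.
    by rewrite -dc -mulgA -expg2 d2 mulg1.
  have caE : c * a^-1 = (a ^+ s)^-1 * c by rewrite -ca !invMg invgK !mulgA mulgKV.
  have cbE : c * b^-1 = (b ^+ (s ^+ 2)%R)^-1 * c.
    by rewrite -cb !invMg invgK !mulgA mulgKV.
  have bx : commute b^-1 (a * (a ^+ s)^-1).
    apply/commute_sym/commuteV/commute_sym/commuteM; first exact/commute_sym.
    by apply/commuteV/commuteX/commute_sym.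
  have abx : a^-1 * b^-1 * (a * (a ^+ s)^-1 * (b * (b ^+ (s ^+ 2)%R)^-1))
      = (a ^+ s)^-1 * (b ^+ (s ^+ 2)%R)^-1.
    by rewrite mulgA -(mulgA a^-1) bx !mulgA mulVg mul1g mulgKV.
  rewrite /commute /e -(mulgA _ d c) dcE.
  rewrite (expgD_Zp 1%R (- s)%R ap') (expgD_Zp 1%R (- s ^+ 2)%R bp') !expgN_Zp // !expg1.
  by rewrite 2!(mulgA (a^-1 * b^-1)) abx !(mulgA c) caE -(mulgA _ c b^-1) cbE !mulgA.
pose t := e * c.
have t5 : t ^+ 5 = e by rewrite expgMn // c5 mulg1 (expgD e 2 3) (expgD e 2 1) e2 !mul1g.
have t6 : t ^+ 6 = c.
  by rewrite expgMn // (expgM e 2 3) e2 expg1n mul1g (expgD c 5 1) c5 mul1g.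
have t10 : t ^+ 10 = 1 by rewrite (expgM t 5 2) t5.
have ta : a ^ t^-1 = a ^+ sval opp_root.
  rewrite expgN_Zp // invMg conjgM [a ^ c^-1]conjgE invgK mulgA ca eV conjXg.
  by rewrite /e !conjgM conj_a ad expgVn.
have tb : b ^ t^-1 = b ^+ sval opp_sq_root.
  rewrite expgN_Zp // invMg conjgM [b ^ c^-1]conjgE invgK mulgA cb eV conjXg.
  by rewrite /e !conjgM conj_b bd expgVn.
have [f [fa fb ft]] := twisted_morphism p_prime ap bp t10 ab ta tb.
apply/homgP; exists f; apply/eqP; rewrite eqEsubset; apply/andP; split.
  have := subxx H; rewrite -{1}genH !join_subG !cycle_subG -!andbA => /and4P[Ha Hb Hc Hd].
  apply/subsetP=> _ /morphimP[g _ _ ->]; move: g; apply: tw_ind => u v i.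
  rewrite tw_decomp !morphM ?inE // !morphX ?inE //.
  by rewrite fa fb ft !groupM ?groupX // !groupM ?groupV.
rewrite -genH !join_subG !cycle_subG.
have fT g : f g \in f @* [set: Ghat] by rewrite mem_morphim ?inE.
have Ia : a \in f @* [set: Ghat] by rewrite -fa.
have Ib : b \in f @* [set: Ghat] by rewrite -fb.
have It : t \in f @* [set: Ghat] by rewrite -ft.
rewrite Ia Ib -{1}t6 groupX //=.
have -> : d = b * (a * e) by rewrite /e -mulgA !mulKVg.
have Ie : e \in f @* [set: Ghat] by rewrite -t5 groupX.
exact: groupM Ib (groupM Ia Ie).
Qed.

End Rels_homg.

Lemma isog_Ghat_twisted : isog_Ghat s [set: Ghat]%G.
Proof.
apply: intro_isoGrp; first by apply/homg_Ghat_relsP; apply: Ghat_gens.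
by move=> rT H /homg_Ghat_relsP[a [b [c [d [gen rel]]]]]; apply: homg_Ghat gen rel.
Qed.

End Ghat.

(** * The maps and their classification *)

Lemma orient_iso_rotX M N n :
  orient_iso M N -> dart_rot M ^+ n = 1 -> dart_rot N ^+ n = 1.
Proof.
move=> [f [[g fK gK] fr _]] rotM; apply/permP=> y; rewrite perm1 -[y]gK.
have fX m x : f ((dart_rot M ^+ m) x) = (dart_rot N ^+ m) (f x).
  by elim: m x => [|m IHm] x; rewrite ?perm1 // !expgSr !permM fr IHm.
by rewrite -fX rotM perm1.
Qed.

Section Maps.

Variables (p : nat) (s : 'F_p).
Hypotheses (p_prime : prime p) (p_ge11 : 11 <= p).
Hypothesis s_prim : (5.-primitive_root s)%R.

Local Notation G :=
  (twisted (opp_root p_prime p_ge11 s_prim) (opp_sq_root p_prime p_ge11 s_prim)).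
Local Notation la_prim := (opp_root_prim p_prime p_ge11 s_prim).
Local Notation mu_prim := (opp_sq_root_prim p_prime p_ge11 s_prim).

Lemma cayley_iso_rot_part (r l r' l' : G)
    (P : rotary_pair r l) (P' : rotary_pair r' l') :
  orient_iso (cayley_map P) (cayley_map P') -> rot_part r = rot_part r'.
Proof.
case/morph_of_cayley_iso=> phi [bphi phiM <- _].
apply/esym/(rot_part_aut la_prim mu_prim) => //; last exact: bij_inj.
exact: opp_no_swap.
Qed.

(** Both pairs are images of the same standard pair. *)
Lemma rot_part_cayley_iso (r l r' l' : G)
    (P : rotary_pair r l) (P' : rotary_pair r' l') :
  rot_part r = rot_part r' -> orient_iso (cayley_map P) (cayley_map P').
Proof.
move=> eq_rot.
have [phi [[psi phiK psiK] phiM phir phil]] := rotary_normal_form la_prim mu_prim P.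
have [phi' [bphi' phi'M phi'r phi'l]] := rotary_normal_form la_prim mu_prim P'.
apply: (@cayley_iso_of_morph _ _ _ _ _ _ P P' (phi' \o psi)).
- by apply: bij_comp => //; exists phi.
- move=> x y /=; rewrite -phi'M; congr phi'.
  by apply: (can_inj phiK); rewrite phiM !psiK.
- by rewrite -phir /= phiK eq_rot.
by rewrite -phil /= phiK.
Qed.

Definition std_pair k (k_unit : k \is a GRing.unit) :
    rotary_pair (tw 1 1 k : G) (tw 0 0 5%:R) :=
  standard_rotary la_prim mu_prim (opp_neq_sq s_prim) k_unit.

Definition std_map k (k_unit : k \is a GRing.unit) : oriented_map :=
  cayley_map (std_pair k_unit).

Lemma Z10_unit_neqN (k : 'Z_10) : k \is a GRing.unit -> k != (- k)%R.
Proof. by case: k; do 10! [case=> [//|]]. Qed.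

Lemma std_map_chiral k (k_unit : k \is a GRing.unit) : chiral_map (std_map k_unit).
Proof.
split=> [|[_ [f [fr fl]]]]; first exact: cayley_regular.
have iso_mirror : orient_iso (std_map k_unit) (map_mirror (std_map k_unit)).
  by exists f; split=> //; exists (f^-1); [apply: permK | apply: permKV].
have iso := orient_iso_trans iso_mirror (mirror_cayley (std_pair k_unit)).
have := cayley_iso_rot_part iso.
by apply/eqP/Z10_unit_neqN.
Qed.

Lemma std_map_counted k (k_unit : k \is a GRing.unit) : counted_map s (std_map k_unit).
Proof.
have or : #[tw 1 1 k : G] = 10.
  by apply: order_standard_rot k_unit; [exact: la_prim | exact: mu_prim].
have of5 : #[(tw 1 1 k : G)^-1 * tw 0 0 5%:R] = 5.
  by apply: order_standard_face k_unit; [exact: la_prim | exact: mu_prim].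
have ol : #[tw 0 0 5%:R : G] = 2 := (std_pair k_unit).1.
split.
- exact: std_map_chiral.
- have card_orbits (x : G) : (#|porbits (lmul x)| * #[x])%N = (10 * p ^ 2)%N.
    by rewrite card_porbits_lmul -cardsT card_Ghat.
  have cV : (#|vertices (std_map k_unit)| * 10)%N = (10 * p ^ 2)%N.
    by have := card_orbits (tw 1 1 k); rewrite or.
  have cE : (#|edges (std_map k_unit)| * 2)%N = (10 * p ^ 2)%N.
    by have := card_orbits (tw 0 0 5%:R); rewrite ol.
  have cF : (#|faces (std_map k_unit)| * 5)%N = (10 * p ^ 2)%N.
    rewrite /faces cayley_faceE.
    by have := card_orbits ((tw 1 1 k)^-1 * tw 0 0 5%:R); rewrite of5.
  rewrite /euler_char; lia.
- by have := cayley_type (std_pair k_unit); rewrite or of5.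
exact: isoGrp_trans (isog_AutP_cayley _) (isog_Ghat_twisted _ _ _).
Qed.

Lemma std_map_iso_inj k k' (k_unit : k \is a GRing.unit)
    (k'_unit : k' \is a GRing.unit) :
  orient_iso (std_map k_unit) (std_map k'_unit) -> k = k'.
Proof. exact: cayley_iso_rot_part. Qed.

Lemma mirror_std_map_iso k k' (k_unit : k \is a GRing.unit)
    (k'_unit : k' \is a GRing.unit) :
  orient_iso (map_mirror (std_map k_unit)) (std_map k'_unit) -> (- k = k')%R.
Proof.
move=> iso; have iso' := orient_iso_sym (mirror_cayley (std_pair k_unit)).
exact: cayley_iso_rot_part (orient_iso_trans iso' iso).
Qed.

(** The faces of a standard map have size 5, so after dualising the rotation has
    order 5, whereas a standard map has vertices of degree 10. *)
Lemma std_map_dual_not_pair k k' (k_unit : k \is a GRing.unit)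
    (k'_unit : k' \is a GRing.unit) :
  ~ same_pair (map_dual (std_map k_unit)) (std_map k'_unit).
Proof.
have face5 : dart_face (std_map k_unit) ^+ 5 = 1.
  apply/eqP; rewrite cayley_faceE -order_dvdn order_lmul.
  by rewrite (order_standard_face la_prim mu_prim k_unit).
have rot5 : dart_rot (std_map k'_unit) ^+ 5 <> 1.
  move/eqP; rewrite -order_dvdn order_lmul.
  by rewrite (order_standard_rot la_prim mu_prim k'_unit).
case=> /orient_iso_rotX-/(_ 5) iso; apply/rot5/iso => //.
by rewrite expgVn face5 invg1.
Qed.

Lemma counted_map_std N : counted_map s N ->
  exists (r l : G) (P : rotary_pair r l),
    rot_part r \is a GRing.unit /\ orient_iso (cayley_map P) N.
Proof.
case=> [[regN _] _ typeN isoN].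
have isog_N : AutP N \isog [set: G].
  rewrite isogEhom (isog_Ghat_twisted p_prime p_ge11 s_prim) (isoGrp_hom isoN) /=.
  by rewrite isoN; apply: isoGrp_hom; apply: isog_Ghat_twisted.
have [r [l [P isoP]]] := regular_cayley regN isog_N.
exists r, l, P; split=> //.
exact: (rotary_rot_part_unit la_prim P (iso_face_order isoP typeN)).
Qed.

(** The four units of Z/10 are 1, 3 and their opposites, which the mirror images
    account for. *)
Lemma counted_map_pair N (u1 : (1%:R : 'Z_10)%R \is a GRing.unit)
    (u3 : (3%:R : 'Z_10)%R \is a GRing.unit) :
  counted_map s N -> same_pair (std_map u1) N \/ same_pair (std_map u3) N.
Proof.
case/counted_map_std=> r [l [P [r_unit isoP]]].
have std_iso k (ku : k \is a GRing.unit) : k = rot_part r -> orient_iso (std_map ku) N.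
  by move=> kr; apply: orient_iso_trans isoP; apply: rot_part_cayley_iso.
have mirror_iso k (ku : k \is a GRing.unit) :
    (- k)%R = rot_part r -> orient_iso (map_mirror (std_map ku)) N.
  move=> kr; apply: orient_iso_trans isoP; apply: orient_iso_trans (mirror_cayley _) _.
  exact: rot_part_cayley_iso.
have := r_unit; have : rot_part r \in [:: 1; - 1; 3%:R; - 3%:R]%R.
  by case: (rot_part r) r_unit; do 10! [case=> [//|]].
rewrite !inE => /or4P[] /eqP kr _.
- by left; left; apply: std_iso.
- by left; right; apply: mirror_iso.
- by right; left; apply: std_iso.
by right; right; apply: mirror_iso.
Qed.

End Maps.

Theorem corollaryB2 (p : nat) (s : 'F_p)
    (p_prime : prime p) (p_ge11 : 11 <= p) (p_mod5 : p = 1 %[mod 5])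
    (s_prim : (5.-primitive_root s)%R) :
  exists M1 M2 : oriented_map,
    [/\ counted_map s M1,
        counted_map s M2,
        ~ same_pair_up_to_duality M1 M2
      & forall N : oriented_map, counted_map s N -> same_pair M1 N \/ same_pair M2 N].
Proof.
have u1 : (1%:R : 'Z_10)%R \is a GRing.unit by [].
have u3 : (3%:R : 'Z_10)%R \is a GRing.unit by [].
exists (std_map p_prime p_ge11 s_prim u1), (std_map p_prime p_ge11 s_prim u3).
split; try exact: std_map_counted; last by move=> N; apply: counted_map_pair.
case=> [[/std_map_iso_inj | /mirror_std_map_iso] //|].
exact: std_map_dual_not_pair.
Qed.
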